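(* For all integers $k\geq 0$ and $d\geq 2k-1$ with $d\geq 0$, $$\lim_{n\rightarrow\infty}\frac{\alpha^k_d(\mathcal{G}_{n,k})}{n}\;=\;\frac{d-2k+1}{d-k+1}.$$
   Context: All graphs are finite, undirected, and simple. The treewidth of a graph $G$ is the minimum integer $k$ such that $G$ is a subgraph of a chordal graph with no clique on more than $k+1$ vertices. $\mathcal{G}_{n,k}$ denotes the family of $n$-vertex graphs with treewidth $k$ (nonempty exactly when $n\geq k+1$). For a graph $G$ and integers $t,d\geq 0$, $\alpha_d^t(G)$ denotes the maximum cardinality of a set $S\subseteq V(G)$ such that every vertex of $S$ has degree at most $d$ in $G$ and the induced subgraph $G[S]$ has treewidth at most $t$ (the empty set is allowed as $S$). In particular, if $G$ has treewidth $k$, then $\alpha_d^k(G)$ is the number of vertices of $G$ of degree at most $d$. For a family $\mathcal{G}$ of graphs, $\alpha_d^t(\mathcal{G})$ is the minimum of $\alpha_d^t(G)$ over all $G\in\mathcal{G}$. *)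

(* Defs.v *)
From HB Require Import structures.
From mathcomp Require Import all_boot all_order all_algebra.
From mathcomp Require Import all_classical all_reals all_analysis.
Import Order.TTheory GRing.Theory Num.Theory.
Import numFieldNormedType.Exports.

Set Implicit Arguments.
Unset Strict Implicit.
Unset Printing Implicit Defensive.

Local Open Scope ring_scope.

Record sgraph := SGraph {
  vertex :> finType;
  adj : rel vertex;
  adj_sym : symmetric adj;
  adj_irr : irreflexive adj }.

Definition deg (G : sgraph) (x : G) : nat := #|[pred y | adj x y]|.

Section Induced.
Variables (G : sgraph) (S : {set G}).

Definition induced_adj : rel {x : G | x \in S} :=
  [rel x y | adj (val x) (val y)].

Lemma induced_sym : symmetric induced_adj.
Proof. by move=> x y; exact: adj_sym. Qed.

Lemma induced_irr : irreflexive induced_adj.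
Proof. by move=> x; exact: adj_irr. Qed.

Definition induced : sgraph := SGraph induced_sym induced_irr.
End Induced.

Definition clique (G : sgraph) (K : {set G}) : Prop :=
  {in K &, forall x y, x != y -> adj x y}.

(* Every cycle on at least four vertices has a chord, that is, an edge between
   two of its vertices that are not consecutive on it. *)
Definition chordal (G : sgraph) : Prop :=
  forall c : seq G, ucycle (@adj G) c -> (4 <= size c)%N ->
    exists x y, [/\ x \in c, y \in c, adj x y, y != next c x & x != next c y].

Definition subgraph (G H : sgraph) : Prop :=
  exists2 f : G -> H, injective f & {homo f : x y / adj x y}.

Definition has_chordal_supergraph (G : sgraph) (k : int) : Prop :=
  exists H : sgraph, [/\ subgraph G H, chordal H &
    forall K : {set H}, clique K -> #|K|%:Z <= k + 1].

(* The minimum is over all integers, so the graph without vertices has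
   treewidth -1. The default value 0 is never used, see treewidthP. *)
Definition treewidth (G : sgraph) : int :=
  xget 0 [set k : int | has_chordal_supergraph G k /\
                        forall j : int, has_chordal_supergraph G j -> k <= j]%classic.

Definition alpha (t d : nat) (G : sgraph) : nat :=
  \max_(S : {set G} | [forall x in S, (deg x <= d)%N] &&
                      (treewidth (induced S) <= t%:Z)) #|S|.

(* The minimum of alpha t d over a family; 0 if the family is empty. *)
Definition alpha_family (t d : nat) (F : sgraph -> Prop) : nat :=
  xget 0%N [set m | (exists2 G, F G & alpha t d G = m) /\
                    forall G, F G -> (m <= alpha t d G)%N]%classic.

Definition tw_graphs (n k : nat) (G : sgraph) : Prop :=
  #|G| = n /\ treewidth G = k%:Z.

Section Complete.
Variable T : finType.

Definition complete_adj : rel T := [rel x y | x != y].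

Lemma complete_sym : symmetric complete_adj.
Proof. by move=> x y; rewrite /complete_adj /= eq_sym. Qed.

Lemma complete_irr : irreflexive complete_adj.
Proof. by move=> x; rewrite /complete_adj /= eqxx. Qed.

Definition complete : sgraph := SGraph complete_sym complete_irr.

Lemma complete_chordal : chordal complete.
Proof.
case=> [|a [|b [|c [|e s]]]] // /andP[_ U] _; exists a, c.
have := U; rewrite /= !inE !negb_or -!andbA.
case/and5P=> ab ac ae aS /and5P[bc be bS ce /andP[cS _]].
have ca : (c == a) = false by rewrite eq_sym (negPf ac).
have cb : (c == b) = false by rewrite eq_sym (negPf bc).
by split; rewrite ?inE /= ?eqxx ?orbT ?ca ?cb // ?eqxx.
Qed.
End Complete.

Lemma treewidthP (G : sgraph) :
  has_chordal_supergraph G (treewidth G) /\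
  forall j : int, has_chordal_supergraph G j -> treewidth G <= j.
Proof.
have ge0 k : has_chordal_supergraph G k -> 0 <= k + 1.
  case=> H [_ _ /(_ finset.set0)]; rewrite cards0; apply.
  by move=> x y; rewrite inE.
have ex : exists m : nat, `[< has_chordal_supergraph G (m%:Z - 1) >].
  exists #|G|; apply/asboolP; exists (complete G); split.
  - exists id => // x y xy; rewrite /= /complete_adj /=.
    by apply/eqP => exy; rewrite exy adj_irr in xy.
  - exact: complete_chordal.
  - by move=> K _; rewrite subrK lez_nat; exact: max_card.
rewrite /treewidth; case: xgetP => [k _ //|none].
exfalso; case: (ex_minnP ex) => m /asboolP Pm mmin.
apply: (none (m%:Z - 1)); split=> // j Pj.
have /ge0 := Pj; case Ej : (j + 1) => [l|//] _.
have jE : j = l%:Z - 1 by rewrite -[LHS](addrK 1) Ej.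
rewrite jE lerD2r lez_nat; apply: mmin; apply/asboolP.
by rewrite -jE.
Qed.

Lemma alpha_familyP (t d : nat) (F : sgraph -> Prop) :
  (exists G, F G) ->
  (exists2 G, F G & alpha t d G = alpha_family t d F) /\
  forall G, F G -> (alpha_family t d F <= alpha t d G)%N.
Proof.
case=> G0 FG0.
have ex : exists m : nat, `[< exists2 G, F G & alpha t d G = m >].
  by exists (alpha t d G0); apply/asboolP; exists G0.
rewrite /alpha_family; case: xgetP => [m _ //|none].
exfalso; case: (ex_minnP ex) => m /asboolP Pm mmin.
apply: (none m); split=> // G FG.
by apply: mmin; apply/asboolP; exists G.
Qed.

(* Main.v *)
(* Put q = d - k + 1 and s = d - 2k + 1. As alpha_d^k counts the vertices of
   degree at most d, let L be their set and H the other n - |L| vertices.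
   Every subgraph of a chordal graph with cliques of size at most k + 1 is
   k-degenerate (a simplicial vertex of the chordal graph has degree at most
   k), so the degrees over H sum to 2 e(H) + e(H, L) <= k |H| + k n, while they
   sum to at least (d + 1) |H|. This gives q |L| >= s n.
   For the upper bound take the k-th power of a path, cut into blocks of k
   consecutive vertices, and join s new vertices to all vertices of each block:
   away from the ends, the path vertices have degree 2k + s = d + 1, and they
   form a proportion k / q of all vertices. *)
Require Import Defs.
From HB Require Import structures.
From mathcomp Require Import all_boot all_order all_algebra.
From mathcomp Require Import all_classical all_reals all_analysis.
From mathcomp Require Import zify lra.
Import Order.TTheory GRing.Theory Num.Theory.
Import numFieldNormedType.Exports.

Set Implicit Arguments.
Unset Strict Implicit.
Unset Printing Implicit Defensive.

Local Open Scope ring_scope.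

(** * Simplicial vertices of chordal graphs *)

Lemma next_cat (T : eqType) (s1 s2 : seq T) (x y : T) :
  uniq (s1 ++ x :: y :: s2) -> next (s1 ++ x :: y :: s2) x = y.
Proof.
move=> U; rewrite -(next_rot (size s1)) // rot_size_cat /= eqxx.
by [].
Qed.

Lemma next_last (T : eqType) (s : seq T) (x y : T) :
  uniq (x :: rcons s y) -> next (x :: rcons s y) y = x.
Proof.
move=> U; rewrite -(next_rot (size s).+1) //.
by rewrite -cats1 -cat_cons (rot_size_cat (x :: s) [:: y]) /= eqxx.
Qed.

(* A shortest path from [a] to [b] meeting the neighbourhood of [v] only in
   [a] and [b] would close up through [v] to a chordless cycle. *)
Lemma chordal_path_adj (G : sgraph) (v a b : G) (p : seq G) :
  chordal G -> adj v a -> adj v b -> a != b ->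
  sorted (@adj G) p -> head v p = a -> last v p = b ->
  {in p, forall x, x != v /\ (adj v x -> x = a \/ x = b)} -> adj a b.
Proof.
move=> chG va vb ab; have [m] := ubnP (size p); elim: m p => // m IH p szp.
move=> sp hp lp pP; apply/negPn/negP => nab.
wlog Up : p szp sp hp lp pP / uniq p.
  case: p szp sp hp lp pP => [|x p] /= szp sp hp lp pP W.
    by move: va; rewrite -hp adj_irr.
  case/shortenP: sp lp => p' sp' Up' sub lp'.
  apply: (W (x :: p')) => //.
    apply: leq_ltn_trans szp; rewrite ltnS; apply: uniq_leq_size => //.
    by case/andP: Up'.
  move=> y; rewrite inE => /orP[/eqP->|/sub yp]; apply: pP; rewrite inE ?eqxx //.
  by rewrite yp orbT.
have vp : v \notin p by apply/negP => /pP[]; rewrite eqxx.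
have Uc : uniq (v :: p) by rewrite /= vp.
have [p' pE] : exists p', p = a :: rcons p' b.
  case: p hp lp ab {szp sp pP Up vp Uc} => [|x p] /= hp; first by move=> <-; rewrite -hp eqxx.
  rewrite hp; case/lastP: p => [|p y] /=; first by move=> ->; rewrite eqxx.
  by rewrite last_rcons => -> _; exists p.
have nva : next (v :: p) v = a by rewrite pE /= eqxx.
have nbv : next (v :: p) b = v.
  by rewrite pE -rcons_cons; apply: next_last; rewrite rcons_cons -pE.
have cyc : cycle (@adj G) (v :: p).
  rewrite /= rcons_path lp adj_sym vb andbT.
  by move: sp; rewrite pE /= va.
have sz4 : (4 <= size (v :: p))%N.
  rewrite pE /= size_rcons; case: p' pE => // pE; exfalso.
  by move: sp; rewrite pE /= andbT; apply/negP.
have ucyc : ucycle (@adj G) (v :: p) by rewrite /ucycle cyc Uc.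
case: (chG _ ucyc sz4) => x [y [xc yc xy nx ny]].
have nov z : z \in v :: p -> adj v z -> z != next (v :: p) v ->
    v != next (v :: p) z -> False.
  rewrite inE => /orP[/eqP->|/pP[_ zP]]; first by rewrite adj_irr.
  by move=> /zP[] ->; rewrite ?nva ?nbv eqxx.
have [xv|xv] := eqVneq x v; first by subst x; exact: (nov y).
have [yv|yv] := eqVneq y v.
  by subst y; apply: (nov x) => //; rewrite adj_sym.
have {xc}xp : x \in p by move: xc; rewrite inE (negPf xv).
have {yc}yp : y \in p by move: yc; rewrite inE (negPf yv).
(* A chord [u w] avoiding [v] shortcuts [p] to a shorter path with the same ends, and the induction
   hypothesis contradicts [nab]. *)
have main p1 u p2 w : p = p1 ++ u :: p2 -> w \in p2 -> adj u w ->
    w != next (v :: p) u -> False.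
  move=> pe wp; case/splitPr: wp pe => p3 p4; case: p3 => [|z p3] pe uw.
    by rewrite pe -cat_cons next_cat ?eqxx // cat_cons -pe.
  move=> _; move/negP: nab; apply; apply: (IH (p1 ++ u :: w :: p4)).
  - by move: szp; rewrite pe !size_cat /= !size_cat /=; clear; lia.
  - move: sp; rewrite pe; case: (p1) => [|t q] /=; rewrite !(cat_path, cat_cons) /=.
      by case/and4P=> _ _ _ ->; rewrite uw.
    by case/and4P=> -> -> _; rewrite cat_path /= uw => /and3P[_ _ ->].
  - by move: hp; rewrite pe; case: (p1).
  - by move: lp; rewrite pe !last_cat /= !last_cat.
  - move=> t tp; apply: pP; rewrite pe; move: tp.
    rewrite !(mem_cat, inE) => /or4P[] ->; rewrite ?orbT //.
case/splitPr: {-1}p / xp (erefl p) => p1 p2 pE2.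
move: yp; rewrite pE2 mem_cat inE => /or3P[yp|/eqP yx|yp].
- case/splitPr: yp pE2 => q1 q2 pE2.
  apply: (main q1 y (q2 ++ x :: p2) x) => //; last by rewrite adj_sym.
    by rewrite pE2 -catA.
  by rewrite mem_cat inE eqxx orbT.
- by move: xy; rewrite yx adj_irr.
- exact: (main p1 x p2 y).
Qed.

(** Dirac's argument, by induction on [#|S|]. Let [C] be the component of [w] among the
    non-neighbours of [v] in [S], and [T] the neighbours of [v] in [S] that see [C]. Then [T] is a
    clique separating [C] from [v], so a vertex of [C] that is simplicial in [C :|: T] is simplicial
    in [S]. Prescribing [v] allows the induction to choose a simplicial vertex outside [T]. *)
Lemma chordal_simplicial (G : sgraph) (S : {set G}) (v : G) :
  chordal G -> v \in S -> (exists2 w, w \in S & (w != v) && ~~ adj v w) ->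
  exists w, [/\ w \in S, w != v, ~~ adj v w & clique [set x in S | adj w x]].
Proof.
move=> chG; have [m] := ubnP #|S|; elim: m S v => // m IH S v cardS.
move=> vS [w wS /andP[wv vw]].
pose A : {set G} := [set x in S | (x != v) && ~~ adj v x].
pose e : rel G := [rel x y | [&& adj x y, x \in A & y \in A]].
pose C : {set G} := [set x | connect e w x].
pose T : {set G} := [set x in S | adj v x & [exists c in C, adj c x]].
have wA : w \in A by rewrite inE wS wv.
have CA x : x \in C -> x \in A.
  rewrite inE => /connectP[p]; elim/last_ind: p => [|p y _] /=; first by move=> _ ->.
  by rewrite rcons_path last_rcons => /andP[_ /and3P[_ _ yA]] ->.
have esym : connect_sym e.
  by apply: sym_connect_sym => x y; rewrite /e /= adj_sym; congr andb; rewrite andbC.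
(* Two vertices of [T] are joined by a path with inner vertices in [C], all of which miss [v]. *)
have clT : clique T.
  move=> a b; rewrite !inE => /and3P[aS va /exists_inP[x xC xa]] /and3P[bS vb /exists_inP[y yC yb]] ab.
  have : connect e x y by move: xC yC; rewrite !inE esym; exact: connect_trans.
  case/connectP=> p ep yp.
  apply: (@chordal_path_adj G v a b (a :: rcons (x :: p) b)) => //.
  - rewrite /= adj_sym xa /= rcons_path -yp yb andbT.
    by apply: sub_path ep => s t /and3P[].
  - by rewrite /= last_rcons.
  - have pA : {in x :: p, forall z, z \in A}.
      move=> z; rewrite inE => /orP[/eqP->|zp]; first exact: CA.
      elim: p {yp} x {xC xa} ep zp => //= t p IHp x /andP[/and3P[_ _ tA] ep].
      by rewrite inE => /orP[/eqP->|] //; apply: IHp ep.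
    move=> z; rewrite inE mem_rcons inE => /or3P[/eqP->|/eqP->|/pA].
    + by split; [apply/eqP => av; rewrite av adj_irr in va|left].
    + by split; [apply/eqP => bv; rewrite bv adj_irr in vb|right].
    + by rewrite inE => /and3P[_ -> /negP].
have nbC c x : c \in C -> x \in S -> adj c x -> x \in C :|: T.
  move=> cC xS cx; rewrite inE.
  have [vx|vx] := boolP (adj v x).
    by apply/orP; right; rewrite inE xS vx; apply/exists_inP; exists c.
  have /CA := cC; rewrite inE => /and3P[cS cv vc].
  have xA : x \in A.
    by rewrite inE xS vx andbT; apply/eqP => xv; move: vc; rewrite adj_sym -xv cx.
  apply/orP; left; move: (cC); rewrite !inE => /connect_trans; apply.
  by apply: connect1; rewrite /e /= cx CA.
have CTS x : x \in C :|: T -> x \in S.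
  by rewrite inE => /orP[/CA|]; rewrite inE => /and3P[].
have simp c : c \in C -> clique [set x in C :|: T | adj c x] ->
    exists w, [/\ w \in S, w != v, ~~ adj v w & clique [set x in S | adj w x]].
  move=> cC cl; have := CA _ cC; rewrite inE => /and3P[cS cv vc].
  exists c; split=> // x y; rewrite !inE => /andP[xS cx] /andP[yS cy].
  have xD := nbC _ _ cC xS cx; have yD := nbC _ _ cC yS cy.
  by apply: cl; rewrite inE ?cx ?cy ?xD ?yD.
have cardD : (#|C :|: T| < m)%N.
  move: cardS; rewrite ltnS; apply: leq_trans; apply: proper_card; apply/properP; split.
    by apply/fintype.subsetP.
  exists v => //; rewrite inE; apply/norP; split; last by rewrite inE adj_irr andbF.
  by apply/negP => /CA; rewrite inE eqxx andbF.
have wC : w \in C by rewrite inE connect0.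
(* Prefer a vertex of the separator [T] that misses some vertex: what it
   misses lies outside the clique [T], hence in [C]. *)
have [/exists_inP[u uT /exists_inP[x xD xP]]|noT] :=
    boolP [exists u in T, exists x in C :|: T, (x != u) && ~~ adj u x].
  case: (IH _ u cardD); [by rewrite inE uT ?orbT|by exists x|].
  move=> c [cD cu uc]; apply: simp; move: cD; rewrite inE => /orP[//|cT].
  by case/negP: uc; apply: clT => //; rewrite eq_sym.
(* By [noT], each vertex of [T] sees all of [C :|: T], so a vertex that misses [u] must lie in
   [C]. *)
have [/exists_inP[u uC /exists_inP[x xD xP]]|noC] :=
    boolP [exists u in C, exists x in C :|: T, (x != u) && ~~ adj u x].
  case: (IH _ u cardD); [by rewrite inE uC ?orbT|by exists x|].
  move=> c [cD cu uc]; apply: simp; move: cD; rewrite inE => /orP[//|cT].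
  case/negP: noT; apply/exists_inP; exists c => //; apply/exists_inP; exists u.
    by rewrite inE uC.
  by rewrite eq_sym cu adj_sym.
(* Now [C :|: T] is a clique, and [w] itself is simplicial. *)
apply: (simp w wC) => x y /setIdP[xD _] /setIdP[yD _] xy; apply/negPn/negP => nxy.
move: (xD); rewrite finset.in_setU => /orP[xC|xT].
  case/negP: noC; apply/exists_inP; exists x => //; apply/exists_inP.
  by exists y; rewrite // eq_sym xy.
case/negP: noT; apply/exists_inP; exists x => //; apply/exists_inP.
by exists y; rewrite // eq_sym xy.
Qed.

(** * Degeneracy and the lower bound *)

Lemma chordal_degenerate (G : sgraph) (k : nat) (S : {set G}) :
  chordal G -> (forall K : {set G}, clique K -> (#|K| <= k.+1)%N) ->
  S != finset.set0 -> exists2 w, w \in S & (#|[set x in S | adj w x]| <= k)%N.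
Proof.
move=> chG clG /set0Pn[v vS].
have [w wS clw] : exists2 w, w \in S & clique [set x in S | adj w x].
  have [/exists_inP[u uS /exists_inP[x xS xP]]|noS] :=
      boolP [exists u in S, exists x in S, (x != u) && ~~ adj u x].
    have [|w [wS _ _ clw]] := @chordal_simplicial G S u chG uS; first by exists x.
    by exists w.
  exists v => // x y /setIdP[xS _] /setIdP[yS _] xy; apply/negPn/negP => nxy.
  case/negP: noS; apply/exists_inP; exists x => //; apply/exists_inP.
  by exists y; rewrite // eq_sym xy.
exists w => //; have := clG (w |: [set x in S | adj w x])%SET.
rewrite cardsU1 inE adj_irr andbF add1n ltnS; apply.
move=> x y /setU1P[->|xN] /setU1P[->|yN]; last exact: clw.
- by rewrite eqxx.
- by case/setIdP: yN.
- by case/setIdP: xN => _; rewrite adj_sym.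
Qed.

Lemma tw_degenerate (G : sgraph) (k : nat) (S : {set G}) :
  has_chordal_supergraph G k%:Z -> S != finset.set0 ->
  exists2 w, w \in S & (#|[set x in S | adj w x]| <= k)%N.
Proof.
case=> H [[f fI fh] chH clH] /set0Pn[v vS].
have clH' (K : {set H}) : clique K -> (#|K| <= k.+1)%N.
  by move/clH; rewrite -PoszD lez_nat addn1.
have [|_ /imsetP[w wS ->] le] := @chordal_degenerate H k (f @: S) chH clH'.
  by apply/set0Pn; exists (f v); exact: imset_f.
exists w => //; apply: leq_trans le; rewrite -(card_imset _ fI); apply: subset_leq_card.
apply/fintype.subsetP => _ /imsetP[x /setIdP[xS wx] ->].
by rewrite inE imset_f //= fh.
Qed.

(* Deleting from [S] a vertex with at most [k] neighbours in [S] lowers the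
   left-hand side by at most [k], or [2 * k] if the vertex is in [H]. *)
Lemma degenerate_degree_sum (G : sgraph) (k : nat) (H S : {set G}) :
  (forall S : {set G}, S != finset.set0 ->
     exists2 w, w \in S & (#|[set x in S | adj w x]| <= k)%N) ->
  H \subset S ->
  (\sum_(x in H) #|[set y in S | adj x y]| <= k * (#|H| + #|S|))%N.
Proof.
move=> dg; have [m] := ubnP #|S|; elim: m H S => // m IH H S cS HS.
have [S0|/dg[w wS dw]] := eqVneq S finset.set0.
  by move: HS; rewrite S0 finset.subset0 => /eqP ->; rewrite big_set0.
have cS' : #|S| = (#|S :\ w|%SET).+1 by rewrite (cardsD1 w) wS.
have := IH (H :\ w)%SET (S :\ w)%SET; rewrite -ltnS -cS' => /(_ cS (finset.setSD _ HS)) IHw.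
have nbS x : #|[set y in S | adj x y]| =
    (#|[set y in (S :\ w)%SET | adj x y]| + adj x w)%N.
  rewrite (cardsD1 w) inE wS /= addnC; congr (#|pred_of_set _| + _)%N.
  by apply/setP => y; rewrite !inE andbA.
have eqH : (\sum_(x in (H :\ w)%SET) #|[set y in S | adj x y]| <=
    k * (#|(H :\ w)%SET| + #|(S :\ w)%SET|) + k)%N.
  under eq_bigr do rewrite nbS.
  rewrite big_split leq_add //; apply: leq_trans dw.
  rewrite -sum1_card big_mkcond [leqRHS]big_mkcond; apply: leq_sum => x _ /=.
  rewrite !inE; case: eqP => // _; case: (boolP (x \in H)) => // xH.
  by rewrite (fintype.subsetP HS) // adj_sym; case: adj.
have [wH|wH] := boolP (w \in H).
  rewrite (big_setD1 w) //= cS' (cardsD1 w H) wH.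
  by apply: leq_trans (leq_add dw eqH) _; lia.
have HE : (H :\ w)%SET = H.
  by apply/setP => x; rewrite !inE; case: eqP => // ->; rewrite (negPf wH).
by rewrite HE in eqH; apply: leq_trans eqH _; rewrite cS'; lia.
Qed.

(** This is the degree sum over the vertices of degree above [d]: their number plus [#|G|] is the
    difference multiplied by [k]. Adding [d.+1] times the number of remaining vertices to both sides
    turns the left one into [d.+1 * #|G|]. *)
Lemma low_degree_count (G : sgraph) (k d : nat) :
  has_chordal_supergraph G k%:Z ->
  (d.+1 * #|G| <= k * (2 * #|G| - #|[set x : G | (deg x <= d)%N]|) +
     d.+1 * #|[set x : G | (deg x <= d)%N]|)%N.
Proof.
move=> tw; set L := [set x : G | _].
have cG : #|G| = (#|L| + #|~: L|%SET)%N by rewrite cardsC.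
have := @degenerate_degree_sum G k (~: L)%SET [set: G] (fun S => @tw_degenerate G k S tw) (finset.subsetT _).
have : (d.+1 * #|~: L|%SET <= \sum_(x in (~: L)%SET) #|[set y in [set: G] | adj x y]|)%N.
  rewrite mulnC -sum_nat_const; apply: leq_sum => x; rewrite !inE -ltnNge => lt.
  rewrite (leq_trans lt) // /deg; apply: subset_leq_card.
  by apply/fintype.subsetP => y; rewrite !inE.
rewrite cardsT => h1 h2; have := leq_trans h1 h2; rewrite cG; clear; nia.
Qed.

(** Every induced subgraph embeds in the same chordal supergraph, so the treewidth condition on [S]
    always holds and the set of all vertices of degree at most [d] is optimal. *)
Lemma alphaE (G : sgraph) (k d : nat) :
  has_chordal_supergraph G k%:Z -> alpha k d G = #|[set x : G | (deg x <= d)%N]|.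
Proof.
move=> [H [[f fI fh] chH clH]]; apply/eqP; rewrite eqn_leq; apply/andP; split.
  apply/bigmax_leqP => S /andP[/forall_inP Sd _]; apply: subset_leq_card.
  by apply/fintype.subsetP => x /Sd; rewrite inE.
apply: (@leq_bigmax_cond _ _ (fun S : {set G} => #|S|)).
apply/andP; split; first by apply/forall_inP => x; rewrite inE.
apply: (treewidthP _).2; exists H; split=> //; exists (f \o val) => [|x y] /=.
  exact: inj_comp fI val_inj.
exact: fh.
Qed.

(** * Upper bound: elimination orderings and the block graph *)

(** On a cycle, the vertex [x] of largest rank has both cycle neighbours before it, so they are
    adjacent. This edge is a chord, since on a cycle of length at least four they are not
    consecutive. *)
Lemma elimination_chordal (G : sgraph) (r : G -> nat) :
  injective r ->
  (forall x y z : G, (r y < r x)%N -> (r z < r x)%N -> y != z ->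
     adj x y -> adj x z -> adj y z) ->
  chordal G.
Proof.
move=> rI elim c /andP[cc Uc] c4.
have [x xc xmax] : exists2 x, x \in c & {in c, forall y, (r y <= r x)%N}.
  case: c c4 {cc Uc} => // x0 c _.
  case: (@arg_maxnP _ x0 (mem (x0 :: c)) r) => [|x xc xmax]; first exact: mem_head.
  by exists x.
have lt y : y \in c -> adj x y -> (r y < r x)%N.
  move=> yc xy; rewrite ltn_neqAle xmax // andbT; apply/eqP => /rI e.
  by move: xy; rewrite e adj_irr.
case: (rot_to xc) => i s cE.
have Us : uniq (x :: s) by rewrite -cE rot_uniq.
have cs : cycle (@adj G) (x :: s) by rewrite -cE rot_cycle.
have nx z : next c z = next (x :: s) z by rewrite -cE next_rot.
have mx z : (z \in c) = (z \in x :: s) by rewrite -cE mem_rot.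
have ss : (3 <= size s)%N by rewrite -ltnS -[(size s).+1]/(size (x :: s)) -cE size_rot.
case: s ss Us cs nx mx {cE} => [|y [|t s]] //; case/lastP: s => [|s z] // _ Us cs nx mx.
have yc : y \in c by rewrite mx !inE eqxx orbT.
have zc : z \in c by rewrite mx !inE mem_rcons inE eqxx !orbT.
have [xy xz] : adj x y /\ adj x z.
  move: cs => /=; rewrite rcons_path last_rcons [adj z x]adj_sym.
  by case/and3P=> -> _ /andP[_ ->].
have /and3P[yN tN _] : [&& y \notin (t :: rcons s z), t \notin rcons s z & true].
  by move: Us => /= /and4P[_ -> ->].
have yz : y != z.
  by apply: contraNneq yN => ->; rewrite inE mem_rcons mem_head orbT.
exists y, z; split=> //.
- exact: (elim x y z (lt _ _ _) (lt _ _ _)).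
- rewrite nx (@next_cat _ [:: x] (rcons s z) y t) //.
  by apply: contraNneq tN => ->; rewrite mem_rcons mem_head.
- rewrite nx (@next_last _ [:: y, t & s] x z) //.
  by move: Us => /= /andP[]; rewrite inE negb_or eq_sym => /andP[].
Qed.

Section BlockGraph.
Variables (k s n : nat).
Let q := (k + s)%N.

(* The vertices [q * b], ..., [q * b + q - 1] form the block [b], of which the
   first [k] lie on the path. [block_pos] is the position on the path, and a
   vertex off the path is placed just after its block, so that the [k]
   preceding positions are its neighbours. *)
Definition block_pos (i : nat) : nat := (k * (i %/ q) + minn (i %% q) k)%N.

(* [e] is a neighbour of [i] that precedes it in the numbering, which is
   the reverse of a perfect elimination ordering. *)
Definition block_back (e i : nat) : bool :=
  [&& (e < i)%N, (e %% q < k)%N & (block_pos i <= block_pos e + k)%N].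

Definition block_adj : rel 'I_n := fun i j => block_back i j || block_back j i.

Lemma block_sym : symmetric block_adj.
Proof. by move=> i j; rewrite /block_adj orbC. Qed.

Lemma block_irr : irreflexive block_adj.
Proof. by move=> i; rewrite /block_adj /block_back ltnn. Qed.

Definition block_graph : sgraph := SGraph block_sym block_irr.

(** Strictness relies on [e] being on the path: the [s] vertices that end a block all share one
    position. *)
Lemma block_pos_lt e i : (e < i)%N -> (e %% q < k)%N -> (block_pos e < block_pos i)%N.
Proof.
rewrite /block_pos => ei ek; rewrite (minn_idPl (ltnW ek)).
have q0 : (0 < q)%N by rewrite /q addn_gt0 (leq_ltn_trans _ ek).
have [lt|gt|eq] := ltngtP (e %/ q) (i %/ q)%N.
- have : (k * (e %/ q).+1 <= k * (i %/ q))%N by rewrite leq_mul2l lt orbT.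
  by rewrite mulnS; lia.
- by move: gt; rewrite ltnNge leq_div2r // ltnW.
- rewrite eq ltn_add2l leq_min ek andbT.
  by move: ei; rewrite {1}(divn_eq e q) {1}(divn_eq i q) eq ltn_add2l.
Qed.

Lemma block_backP (i j : block_graph) :
  (i < j)%N -> adj i j -> block_back i j.
Proof. by move=> ij /orP[//|/andP[]]; rewrite ltnNge ltnW. Qed.

Lemma block_chordal : chordal block_graph.
Proof.
apply: (@elimination_chordal block_graph (@nat_of_ord n)); first exact: val_inj.
move=> x y z yx zx yz xy xz.
have /and3P[_ hy py] : block_back y x by apply: block_backP; rewrite // adj_sym.
have /and3P[_ hz pz] : block_back z x by apply: block_backP; rewrite // adj_sym.
rewrite /= /block_adj /block_back hy hz /=.
have := block_pos_lt yx hy; have := block_pos_lt zx hz.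
move: (block_pos _) (block_pos _) (block_pos _) py pz => a b c.
have := yz; rewrite -val_eqE /= neq_ltn => /orP[]->; clear; lia.
Qed.

Lemma block_clique (K : {set block_graph}) : clique K -> (#|K| <= k.+1)%N.
Proof.
move=> cK; have [->|/set0Pn[x0 x0K]] := eqVneq K finset.set0; first by rewrite cards0.
case: (@arg_maxnP _ x0 (mem K) (@nat_of_ord n) x0K) => x xK0 xmax; have xK : x \in K := xK0.
rewrite (cardsD1 x) xK add1n ltnS.
have back y : y \in (K :\ x)%SET -> block_back y x.
  case/setD1P=> yx yK; apply: block_backP; last exact: cK.
  by rewrite ltn_neqAle val_eqE yx; exact: xmax.
(* With [x] the last vertex of [K], the other vertices precede it at distinct distances between 1
   and [k]; the value 0 is excluded below. *)
pose f (y : block_graph) : 'I_k.+1 := inord (block_pos x - block_pos y).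
have fE y : y \in (K :\ x)%SET -> f y = (block_pos x - block_pos y)%N :> nat.
  by move/back=> /and3P[_ _ le]; rewrite inordK // ltnS leq_subLR.
have fI : {in (K :\ x)%SET &, injective f}.
  move=> y z yK zK /(congr1 val); rewrite /= !fE //.
  have /and3P[yx hy _] := back _ yK; have /and3P[zx hz _] := back _ zK.
  have := block_pos_lt yx hy; have := block_pos_lt zx hz => lz ly e.
  apply/eqP; rewrite -val_eqE /=; apply/negPn/negP; rewrite neq_ltn => /orP[] lt.
    by have := block_pos_lt lt hy; lia.
  by have := block_pos_lt lt hz; lia.
rewrite -(card_in_imset fI).
apply: (@leq_trans #|[set~ (ord0 : 'I_k.+1)]%SET|); last by rewrite cardsC1 card_ord.
apply: subset_leq_card; apply/fintype.subsetP => _ /imsetP[y yK ->].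
rewrite !inE -val_eqE /= fE // -lt0n subn_gt0.
by have /and3P[yx hy _] := back _ yK; exact: block_pos_lt.
Qed.

Lemma block_tw : has_chordal_supergraph block_graph k%:Z.
Proof.
exists block_graph; split=> [||K /block_clique]; last by rewrite -PoszD addn1.
  by exists id.
exact: block_chordal.
Qed.

(* The inverse of [block_pos] on the path. *)
Definition block_high (p : nat) : nat := (q * (p %/ k) + p %% k)%N.

Lemma block_highP p : (0 < k)%N ->
  [/\ (block_high p %/ q = p %/ k)%N, (block_high p %% q = p %% k)%N &
      block_pos (block_high p) = p].
Proof.
move=> k0; have pk : (p %% k < k)%N by rewrite ltn_mod.
have pq : (p %% k < q)%N by apply: leq_trans pk _; rewrite leq_addr.
have e1 : (block_high p %/ q = p %/ k)%N.
  by rewrite /block_high mulnC divnMDl ?(leq_ltn_trans _ pq) // (divn_small pq) addn0.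
have e2 : (block_high p %% q = p %% k)%N by rewrite /block_high mulnC modnMDl modn_small.
split=> //; rewrite /block_pos e1 e2 (minn_idPl (ltnW pk)) mulnC.
by rewrite -divn_eq.
Qed.

Lemma block_high_mono p p' : (0 < k)%N -> (p < p')%N -> (block_high p < block_high p')%N.
Proof.
move=> k0 pp; rewrite ltnNge; apply/negP; rewrite leq_eqVlt.
have [_ _ e] := block_highP p k0; have [_ e2 e'] := block_highP p' k0.
case/orP=> [/eqP h|h]; first by move: pp; rewrite -e -e' h ltnn.
have := block_pos_lt h; rewrite e2 ltn_mod k0 e e' => /(_ isT).
by rewrite ltnNge ltnW.
Qed.

Lemma block_high_back p p' : (0 < k)%N -> (p < p' <= p + k)%N ->
  block_back (block_high p) (block_high p').
Proof.
move=> k0 /andP[lt le]; rewrite /block_back block_high_mono //=.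
have [_ -> ->] := block_highP p k0; have [_ _ ->] := block_highP p' k0.
by rewrite ltn_mod k0.
Qed.

Lemma block_high_lt m p : (0 < k)%N -> (p < k * m)%N -> (block_high p < q * m)%N.
Proof.
move=> k0 pm; have : (p %/ k < m)%N by rewrite ltn_divLR // mulnC.
move=> lt; apply: (@leq_trans (q * (p %/ k).+1)%N); last by rewrite leq_mul2l lt orbT.
rewrite mulnS /block_high addnC ltn_add2r.
by apply: leq_trans (leq_addr _ _); rewrite ltn_mod.
Qed.

Lemma block_low_back p t : (0 < k)%N -> (t < s)%N ->
  block_back (block_high p) (q * (p %/ k) + k + t)%N.
Proof.
move=> k0 ts; have pk : (p %% k < k)%N by rewrite ltn_mod.
have kt : (k + t < q)%N by rewrite /q ltn_add2l.
have q0 : (0 < q)%N by apply: leq_ltn_trans kt.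
apply/and3P; split.
- by rewrite /block_high -addnA ltn_add2l (leq_trans pk) // leq_addr.
- by have [_ ->] := block_highP p k0.
have [_ _ ->] := block_highP p k0.
have e1 : ((q * (p %/ k) + (k + t)) %/ q = p %/ k)%N.
  by rewrite mulnC divnMDl // (divn_small kt) addn0.
have e2 : ((q * (p %/ k) + (k + t)) %% q = k + t)%N.
  by rewrite mulnC modnMDl modn_small.
rewrite -addnA /block_pos e1 e2 (minn_idPr (leq_addr _ _)) leq_add2r mulnC.
exact: leq_divM.
Qed.

(** The neighbours listed are the [k] path vertices on either side ([hs]) and the [s] vertices
    ending the block of [x] ([ls]). The bounds on [p] keep them all inside the complete blocks,
    hence below [n]. *)
Lemma block_degree (x : block_graph) (p : nat) :
  (0 < k)%N -> (k <= p)%N -> (p + k < k * (n %/ q))%N -> x = block_high p :> nat ->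
  (2 * k + s <= deg x)%N.
Proof.
move=> k0 kp pkn xE.
have qn : (q * (n %/ q) <= n)%N by rewrite mulnC leq_divM.
pose hs := map block_high (iota (p - k) k ++ iota p.+1 k).
pose ls := [seq (q * (p %/ k) + k + t)%N | t <- iota 0 s].
have hI : injective block_high.
  move=> a b h; have [_ _ <-] := block_highP a k0; have [_ _ <-] := block_highP b k0.
  by rewrite h.
have U : uniq (hs ++ ls).
  rewrite cat_uniq !map_inj_uniq //; last by move=> a b /addnI.
  rewrite cat_uniq !iota_uniq !andbT /=; apply/andP; split.
    by apply/hasPn => y; rewrite !mem_iota; clear -kp; lia.
  apply/hasPn => z /mapP[t]; rewrite mem_iota add0n => /andP[_ ts] ->.
  apply/negP => /mapP[y _ h]; have [_ h1 _] := block_highP y k0.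
  have : (y %% k < k)%N by rewrite ltn_mod.
  rewrite -h1 -h -addnA mulnC modnMDl modn_small ?ltn_add2l //.
  by rewrite ltnNge leq_addr.
have M y : y \in hs ++ ls -> (y < n)%N && (block_back x y || block_back y x).
  rewrite mem_cat xE => /orP[/mapP[u]|/mapP[t]].
    rewrite mem_cat !mem_iota => uu ->; apply/andP; split.
      apply: leq_trans qn; apply: block_high_lt => //.
      by clear -uu pkn kp; lia.
    by case/orP: uu => uu; apply/orP; [right|left];
      apply: block_high_back; clear -uu kp; lia.
  rewrite mem_iota add0n => /andP[_ ts] ->; rewrite block_low_back // andbT.
  apply: leq_trans qn.
  have lt : (p %/ k < n %/ q)%N.
    by rewrite ltn_divLR // mulnC (leq_ltn_trans _ pkn) // leq_addr.
  apply: (@leq_trans (q * (p %/ k).+1)%N); last by rewrite leq_mul2l lt orbT.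
  by rewrite mulnS [(q + _)%N]addnC -addnA !ltn_add2l.
have sz : size (hs ++ ls) = (2 * k + s)%N.
  by rewrite size_cat !size_map size_cat !size_iota mul2n addnn.
rewrite -sz /deg cardE -(size_map val); apply: uniq_leq_size => // y /M /andP[yn xy].
apply/mapP; exists (Ordinal yn) => //; rewrite mem_enum inE /=.
exact: xy.
Qed.

(** The complete blocks hold [k * (n %/ q)] path vertices, and all but the first [k] and the last
    [k] of these have degree above [d]. *)
Lemma block_low_degree_count (d : nat) :
  (d < 2 * k + s)%N ->
  (#|[set x : block_graph | (deg x <= d)%N]| <= n - k * (n %/ q - 2))%N.
Proof.
move=> dk; have [->|k0] := posnP k.
  by rewrite mul0n subn0 -[leqRHS](card_ord n); exact: max_card.
set L := [set x | _]; rewrite -[X in (X - _)%N](card_ord n) -(cardsC L).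
have qn : (q * (n %/ q) <= n)%N by rewrite mulnC leq_divM.
have lt (i : 'I_(k * (n %/ q - 2))) : (k + i + k < k * (n %/ q))%N.
  by move: (nat_of_ord i) (ltn_ord i) => j; rewrite mulnBr; lia.
have ltn (i : 'I_(k * (n %/ q - 2))) : (block_high (k + i) < n)%N.
  by apply: leq_trans qn; apply: block_high_lt => //; have := lt i; lia.
pose g i : block_graph := Ordinal (ltn i).
have gI : injective g.
  move=> i j /(congr1 val) /= h; apply: val_inj; apply: (@addnI k).
  have [_ _ <-] := block_highP (k + i) k0; have [_ _ <-] := block_highP (k + j) k0.
  by rewrite h.
have : (#|g @: [set: 'I_(k * (n %/ q - 2))]| <= #|~: L|%SET)%N.
  apply: subset_leq_card; apply/fintype.subsetP => _ /imsetP[i _ ->].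
  rewrite !inE -ltnNge (leq_trans dk) //.
  by apply: (@block_degree _ (k + i)); rewrite ?leq_addr.
rewrite card_imset // cardsT card_ord; lia.
Qed.

(** The path positions from 0 to [k] form a clique on [k.+1] vertices, which survives in every
    supergraph. For positive [k] they fit into two blocks; for [k = 0] the single vertex 0 is
    used. *)
Lemma block_treewidth : (q + q <= n)%N -> (0 < n)%N -> treewidth block_graph = k%:Z.
Proof.
move=> qn n0; apply/eqP; rewrite eq_le.
apply/andP; split; first exact: (treewidthP _).2 block_tw.
have [H [[f fI fh] _ clH]] := (treewidthP block_graph).1.
have lt (i : 'I_k.+1) : (block_high i < n)%N.
  have [k0|k0] := posnP k.
    by rewrite /block_high; case: i => i /=; rewrite k0; case: i => //= _; rewrite div0n mod0n muln0.
  apply: leq_trans qn; rewrite addnn -muln2; apply: block_high_lt => //.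
  by have := ltn_ord i; lia.
pose g i : block_graph := Ordinal (lt i).
have ga (i j : 'I_k.+1) : (i < j)%N -> adj (g i) (g j).
  move=> ij; apply/orP; left; apply: block_high_back; have := ltn_ord j; lia.
have gna (i j : 'I_k.+1) : i != j -> adj (g i) (g j).
  by rewrite -val_eqE neq_ltn => /orP[/ga|/ga] //; rewrite adj_sym.
have gI : injective g.
  move=> i j e; apply/eqP/negPn/negP => /gna; rewrite e.
  by rewrite adj_irr.
have cE : #|f @: (g @: [set: 'I_k.+1])| = k.+1.
  by rewrite !card_imset // cardsT card_ord.
have := clH (f @: (g @: [set: 'I_k.+1])).
rewrite {}cE -[in X in _ -> X](lerD2r 1) -PoszD addn1; apply.
move=> _ _ /imsetP[_ /imsetP[i _ ->] ->] /imsetP[_ /imsetP[j _ ->] ->] ne.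
by apply: fh; apply: gna; apply: contraNneq ne => ->.
Qed.



End BlockGraph.

(** * Explicit bounds and the limit *)

(** In the error [3 * k * q], a share [2 * k * q] pays for the two ends of the path and [k * q] for
    the incomplete last block. *)
Lemma alpha_family_bounds (k s d n : nat) (q := (k + s)%N) :
  d.+1 = (2 * k + s)%N -> (0 < q)%N -> (q + q <= n)%N ->
  (s * n <= q * alpha_family k d (tw_graphs n k) <= s * n + 3 * k * q)%N.
Proof.
move=> ds q0 qn; have n0 : (0 < n)%N by apply: leq_trans qn; rewrite addn_gt0 q0.
have inF : tw_graphs n k (block_graph k s n).
  by split; [exact: card_ord|exact: block_treewidth].
have [[G [cG twG] <-] minF] := alpha_familyP k d (ex_intro _ _ inF).
have := minF _ inF; rewrite (alphaE _ (block_tw k s n)) => aF.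
have := block_low_degree_count n (eq_leq ds) => /(leq_trans aF) {}aF.
have twG' : has_chordal_supergraph G k%:Z by rewrite -twG; exact: (treewidthP G).1.
move: aF; rewrite (alphaE _ twG'); set L := #|[set x : G | _]| => aF.
have LG : (L <= n)%N by rewrite -cG; exact: max_card.
have := low_degree_count d twG'; rewrite -/L cG ds => low.
apply/andP; split; first by move: low; rewrite /q; clear -LG; nia.
have qm : (n %/ q * q <= n)%N by exact: leq_divM.
have qn1 : (n < (n %/ q).+1 * q)%N by exact: ltn_ceil.
move: (n %/ q)%N qm qn1 aF => m qm qn1 aF.
have Lm : (L + k * m <= n + 2 * k)%N.
  (* This makes the truncated subtraction in [aF] exact. *)
  have km : (k * (m - 2) <= n)%N.
    by apply: leq_trans qm; rewrite mulnC leq_mul ?leq_subr ?leq_addr.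
  by move: aF km; rewrite mulnBr; clear; lia.
have h1 : (q * (L + k * m) <= q * (n + 2 * k))%N by rewrite leq_mul2l Lm orbT.
have h2 : (k * n <= k * (m.+1 * q))%N by rewrite leq_mul2l (ltnW qn1) orbT.
rewrite -(leq_add2r (k * n)); move: h1 h2; clear; rewrite /q; nia.
Qed.

Local Open Scope classical_set_scope.

Theorem theorem1 (R : realType) (k d : nat) (hd : 2 * k%:Z - 1 <= d%:Z) :
  (fun n : nat => (alpha_family k d (tw_graphs n k))%:R / n%:R : R) @ \oo -->
  ((d%:R - 2 * k%:R + 1) / (d%:R - k%:R + 1) : R).
Proof.
have [s ds] : exists s, d.+1 = (2 * k + s)%N.
  by exists (d.+1 - 2 * k)%N; lia.
(* If [k = 0], then [s = d.+1] is positive. *)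
have q0 : (0 < k + s)%N by lia.
have dR : d%:R = 2 * k%:R + s%:R - 1 :> R.
  by have := congr1 (fun m => m%:R : R) ds; rewrite natrD natrM -natr1; lra.
have -> : d%:R - 2 * k%:R + 1 = s%:R :> R by rewrite dR; lra.
have -> : d%:R - k%:R + 1 = (k + s)%:R :> R by rewrite dR natrD; lra.
apply/cvgrPdist_le => e e0; near=> n.
have n2 : (k + s + (k + s) <= n)%N by near: n; exact: nbhs_infty_ge.
have n0 : (0 < n)%N by lia.
have /andP[lo up] := alpha_family_bounds ds q0 n2.
(* This makes the error [3 * k * q], divided by [q * n], at most [e]. *)
have en : 3 * k%:R / e <= n%:R :> R by near: n; exact: nbhs_infty_ger.
move: lo up; set a := alpha_family _ _ _.
rewrite -!(ler_nat R) natrD !natrM => lo up.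
have qR : 0 < (k + s)%:R :> R by rewrite ltr0n.
have nR : 0 < n%:R :> R by rewrite ltr0n.
(* The lower bound [lo] gives the sign of the difference, so only [up] remains to be used. *)
rewrite distrC ger0_norm; last first.
  by rewrite subr_ge0 ler_pdivrMr // mulrAC ler_pdivlMr // mulrC mulrC [_ * (k + s)%:R]mulrC.
rewrite lerBlDr ler_pdivrMr // mulrDl.
rewrite ler_pdivrMr // in en.
rewrite -(ler_pM2l qR) mulrDr.
have -> : (k + s)%:R * (s%:R / (k + s)%:R * n%:R) = s%:R * n%:R :> R.
  by rewrite mulrA mulrCA divff ?gt_eqF // mulr1.
nra.
Unshelve. all: by end_near.
Qed.
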